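(* Let $n\in\mathbb{N}$ and $S\subseteq\mathbb{R}^n$. If $S$ is strongly nonconvex, then $S$ is not MICP representable.
   Context: $\mathbb{N}=\{0,1,2,\dots\}$. A set $S\subseteq\mathbb{R}^n$ is strongly nonconvex if there exists an infinite subset $R\subseteq S$ such that for all pairs of distinct points $x,y\in R$, $\frac{x+y}{2}\notin S$. A set $S\subseteq\mathbb{R}^n$ is MICP representable if there exist $p,d\in\mathbb{N}$ and a closed convex set $M\subseteq\mathbb{R}^{n+p+d}$, with variables $(x,y,z)\in\mathbb{R}^n\times\mathbb{R}^p\times\mathbb{R}^d$, such that $S=\{x\in\mathbb{R}^n : \exists y\in\mathbb{R}^p,\ \exists z\in\mathbb{Z}^d,\ (x,y,z)\in M\}$. *)

(* Defs.v *)
From mathcomp Require Import all_boot all_order all_algebra.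
From mathcomp Require Import all_classical all_reals all_analysis.

Set Implicit Arguments.
Unset Strict Implicit.
Unset Printing Implicit Defensive.

Import GRing.Theory Num.Theory numFieldNormedType.Exports.

Local Open Scope classical_set_scope.
Local Open Scope ring_scope.

Definition strongly_nonconvex (R : realType) (n : nat) (S : set 'rV[R]_n) :=
  exists Q : set 'rV[R]_n,
    [/\ Q `<=` S, infinite_set Q &
      forall x y, Q x -> Q y -> x <> y -> ~ S (2^-1 *: (x + y))].

Definition micp_representable (R : realType) (n : nat) (S : set 'rV[R]_n) :=
  exists (p d : nat) (M : set 'rV[R]_(n + p + d)),
    [/\ closed M, convex_set M &
      S = [set x | exists (y : 'rV[R]_p) (z : 'rV[int]_d),
                     M (row_mx (row_mx x y) (map_mx intr z))]].

(* Main.v *)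
(** By the pigeonhole principle, two of the infinitely many points have integer
    witnesses with the same parity vector.  The midpoint of the two
    representations then still has an integral last block, and it lies in the
    convex set [M], so the midpoint of the two points belongs to [S]. *)
Require Import Defs.
From mathcomp Require Import all_boot all_order all_algebra.
From mathcomp Require Import all_classical all_reals all_analysis.
From mathcomp Require Import unstable zify.

Set Implicit Arguments.
Unset Strict Implicit.
Unset Printing Implicit Defensive.

Import GRing.Theory Num.Theory.

Local Open Scope classical_set_scope.
Local Open Scope ring_scope.

(** Otherwise [f] is injective on [A], so [A] is equinumerous with its image in the finite type
    [F]. *)
Lemma infinite_set_pigeonhole (T : Type) (F : finType) (f : T -> F)
    (A : set T) : infinite_set A ->
  exists x y, [/\ A x, A y, x <> y & f x = f y].
Proof.
move=> infA; apply: contrapT => noxy; apply: infA.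
have injf : {in A &, injective f}.
  move=> x y /set_mem Ax /set_mem Ay fxy; apply: contrapT => xy.
  by apply: noxy; exists x, y.
by rewrite -(eq_finite_set (inj_card_eq injf)).
Qed.

Lemma convex_set_midpoint (R : numFieldType) (E : lmodType R)
    (A : set (convex_lmodType E)) (a b : E) :
  convex_set A -> A a -> A b -> A (2^-1 *: (a + b)).
Proof.
move=> cA Aa Ab.
have h0 : 0 <= 2^-1 :> R by rewrite invr_ge0.
have h1 : 2^-1 <= 1 :> R by rewrite invf_le1 ?ler1n.
have /set_mem := cA _ _ (Itv01 h0 h1) (mem_set Aa) (mem_set Ab).
rewrite /conv /= (_ : onem 2^-1 = 2^-1) -?scalerDr//.
by rewrite /onem [X in X - _](splitr 1) div1r addrK.
Qed.

(** Entries of equal parity have an even sum, so integer division by 2 is exact. *)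
Lemma same_parity_midpoint (R : numFieldType) (d : nat) (z1 z2 : 'rV[int]_d) :
  (forall i, (2 %| z1 ord0 i)%Z = (2 %| z2 ord0 i)%Z) ->
  exists w : 'rV[int]_d, map_mx intr w =
    2^-1 *: (map_mx intr z1 + map_mx intr z2) :> 'rV[R]_d.
Proof.
move=> par; exists (\row_i ((z1 ord0 i + z2 ord0 i) %/ 2)%Z).
apply/rowP => i; rewrite !mxE -intrD; move: (par i).
move: (z1 ord0 i) (z2 ord0 i) => a b ab.
have -> : a + b = ((a + b) %/ 2)%Z * 2 by lia.
by rewrite mulzK// intrM mulrC mulfK// pnatr_eq0.
Qed.

Theorem lemma2 (R : realType) (n : nat) (S : set 'rV[R]_n) :
  strongly_nonconvex S -> ~ micp_representable S.
Proof.
move=> [Q [QS infQ midQ]] [p [d [M [_ cM defS]]]].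
have /choice[g gP] x : exists yz : 'rV[R]_p * 'rV[int]_d,
    Q x -> M (row_mx (row_mx x yz.1) (map_mx intr yz.2)).
  (* Choice needs a total function; [(0, 0)] is a dummy value outside [Q]. *)
  have [Qx|nQx] := pselect (Q x); last by exists (0, 0).
  by move: (QS _ Qx); rewrite defS => -[y [z Mxyz]]; exists (y, z).
(* Boolean rows of length [d] form a finite type, as the pigeonhole requires. *)
pose par x : 'rV[bool]_d := \row_i (2 %| (g x).2 ord0 i)%Z.
have [x1 [x2 [Q1 Q2 x12 par12]]] := infinite_set_pigeonhole par infQ.
apply: (midQ _ _ Q1 Q2 x12); rewrite defS.
have [w defw] : exists w : 'rV[int]_d, map_mx intr w =
    2^-1 *: (map_mx intr (g x1).2 + map_mx intr (g x2).2) :> 'rV[R]_d.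
  by apply: same_parity_midpoint => i; move/rowP/(_ i): par12; rewrite !mxE.
exists (2^-1 *: ((g x1).1 + (g x2).1)), w.
(* Blockwise midpoints assemble into the midpoint of the two points of [M]. *)
rewrite defw -!scale_row_mx -!add_row_mx.
exact: (convex_set_midpoint cM (gP _ Q1) (gP _ Q2)).
Qed.
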